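(* Let $k\geq 3$ be an integer. If $G$ is a connected triangle-free graph on at least $(2k-2)(3k-7)^2+3k-6$ vertices, then $G$ is uniquely reconstructible in the class of triangle-free graphs, i.e. $G$ is the only triangle-free graph on the vertex set $V(G)$ that is consistent with $\mathcal{S}_k(G)$ and $\overline{\mathcal{S}}_k(G)$.
   Context: For a graph $G$ on vertex set $V$, $\mathcal{S}_k(G)$ denotes the set of $k$-subsets of $V$ inducing a connected subgraph of $G$ and $\overline{\mathcal{S}}_k(G)$ the set of $k$-subsets inducing a disconnected subgraph. A graph $G'$ on $V$ is consistent with $\mathcal{S}_k(G),\overline{\mathcal{S}}_k(G)$ if $\mathcal{S}_k(G')=\mathcal{S}_k(G)$ and $\overline{\mathcal{S}}_k(G')=\overline{\mathcal{S}}_k(G)$. *)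

(* Defs.v *)
From mathcomp Require Import all_boot.

Set Implicit Arguments.
Unset Strict Implicit.
Unset Printing Implicit Defensive.

Section Graphs.
Variable T : finType.

Definition simple_graph (e : rel T) : Prop := symmetric e /\ irreflexive e.

Definition triangle_free (e : rel T) : Prop :=
  forall x y z : T, ~ [/\ e x y, e y z & e x z].

Definition induced (e : rel T) (A : {set T}) : rel T :=
  [rel x y | [&& x \in A, y \in A & e x y]].

(* The empty set is connected for this predicate. *)
Definition connected_on (e : rel T) (A : {set T}) : bool :=
  [forall x in A, forall y in A, connect (induced e A) x y].

Definition connected_graph (e : rel T) : bool := connected_on e [set: T].

Definition connected_ksets (k : nat) (e : rel T) : {set {set T}} :=
  [set A : {set T} | (#|A| == k) && connected_on e A].

Definition disconnected_ksets (k : nat) (e : rel T) : {set {set T}} :=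
  [set A : {set T} | (#|A| == k) && ~~ connected_on e A].

Definition consistent (k : nat) (e e' : rel T) : Prop :=
  connected_ksets k e' = connected_ksets k e /\
  disconnected_ksets k e' = disconnected_ksets k e.

(* Graphs on T are identified when their adjacency relations agree pointwise. *)
Definition uniquely_reconstructible_in
    (C : rel T -> Prop) (k : nat) (e : rel T) : Prop :=
  C e /\
  forall e' : rel T, simple_graph e' -> C e' -> consistent k e e' -> e' =2 e.

End Graphs.

(* Main.v *)
Require Import Defs.
From mathcomp Require Import all_boot zify.

Set Implicit Arguments.
Unset Strict Implicit.
Unset Printing Implicit Defensive.

(** The connected [k]-sets determine which sets of size at least [k] are
    connected, so it suffices to compare two connected triangle-free graphs [G]
    and [G'] with the same connected sets of size at least [k].  Suppose that
    [v] is in [N = N_G(u)] but not in [N' = N_G'(u)].  Stars centred at [u] and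
    [v] show that [|N'| <= 3k - 7].  The components of [G - u - N'] that meet
    [N] form, together with [u], a connected set of [G] in which [u] is isolated
    for [G'], so they have at most [k - 2] vertices altogether.  Every other
    component is attached to [N'], so by pigeonhole some [x] in [N'] together
    with the components attached to it forms a connected set [B] with at least
    [k] vertices; then [x] is in [N] and [v] has no neighbour in [B].  Hence
    [v |: B] is disconnected while [u |: (v |: B)] is connected, which is
    impossible in [G'], where [u] is not adjacent to [v]. *)

(** * Connectivity inside vertex subsets *)

Section Connectivity.
Variables (T : finType) (e : rel T).
Hypothesis esym : symmetric e.
Implicit Types (A B D U : {set T}) (a b c x y : T).

Lemma connected_onP A :
  reflect {in A &, forall x y, connect (induced e A) x y} (connected_on e A).
Proof.
apply: (iffP forall_inP) => [h x y xA yA|h x xA]; first exact: (forall_inP (h x xA)).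
by apply/forall_inP => y yA; apply: h.
Qed.

Lemma connect_induced_sym A : connect_sym (induced e A).
Proof.
by apply: sym_connect_sym => x y; rewrite /induced /= esym andbCA.
Qed.

Lemma connect_inducedS A B x y :
  A \subset B -> connect (induced e A) x y -> connect (induced e B) x y.
Proof.
move=> /subsetP sAB; apply: connect_sub => a b /and3P[aA bA ab].
by apply: connect1; rewrite /induced /= !sAB.
Qed.

(** By induction along a path: no step inside [D] leaves [U], so the whole path lies in [U]. This
    makes unions of components of [D] connected by their own edges. *)
Lemma connect_induced_closed D U a b :
  (forall x y, x \in U -> induced e D x y -> y \in U) -> a \in U ->
  connect (induced e D) a b -> (b \in U) && connect (induced e U) a b.
Proof.
move=> clU + /connectP[p]; elim: p a => [|c p IHp] a aU /=.
  by move=> _ ->; rewrite aU connect0.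
case/andP=> Dac pthp def_b; have cU := clU _ _ aU Dac.
case/andP: (IHp c cU pthp def_b) => -> /=; apply: connect_trans.
by apply: connect1; case/and3P: Dac => _ _ ac; rewrite /induced /= aU cU.
Qed.

Lemma connected_on_root A c :
  {in A, forall x, connect (induced e A) c x} -> connected_on e A.
Proof.
move=> h; apply/connected_onP => x y xA yA.
by apply: connect_trans (h y yA); rewrite connect_induced_sym h.
Qed.

Lemma connected_on_star A c : {in A, forall x, e c x} -> connected_on e (c |: A).
Proof.
move=> h; apply: (@connected_on_root _ c) => x /setU1P[->|xA]; first exact: connect0.
by apply: connect1; rewrite /induced /= setU11 setU1r ?h.
Qed.

Lemma connected_on_add A a x :
  connected_on e A -> a \in A -> e a x -> connected_on e (x |: A).
Proof.
move=> /connected_onP cA aA ax; apply: (@connected_on_root _ a) => y /setU1P[->|yA].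
  by apply: connect1; rewrite /induced /= setU11 setU1r.
exact: connect_inducedS (subsetUr _ _) (cA _ _ aA yA).
Qed.

(** The required edge is the first one by which a path in [A] from [a] to [b] leaves [U]. *)
Lemma connected_on_cut A U a b :
  connected_on e A -> a \in A -> a \in U -> b \in A -> b \notin U ->
  exists x y, [/\ x \in A, x \in U, y \in A, y \notin U & e x y].
Proof.
move=> /connected_onP cA aA aU bA; have /connectP[p] := cA _ _ aA bA.
elim: p a aU {aA} => [|c p IHp] a aU /=; first by move=> _ ->; rewrite aU.
case/andP=> /and3P[aA cA' ac] pthp def_b bU.
case cU: (c \in U); first exact: IHp cU pthp def_b bU.
by exists a, c; rewrite cU.
Qed.

Lemma connected_on_neighbour A x :
  connected_on e A -> x \in A -> 1 < #|A| -> exists2 y, y \in A & e x y.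
Proof.
move=> cA xA; rewrite (cardsD1 x) xA => /card_gt0P[b /setD1P[bx bA]].
have [|z [y [_ /set1P-> yA _ xy]]] := connected_on_cut cA xA (set11 x) bA.
  by rewrite inE.
by exists y.
Qed.

(** As long as the current set is smaller than [m], some edge inside [A] leaves it; adding the outer
    endpoint keeps it connected. The induction is on the number of missing vertices. *)
Lemma connected_on_grow A B m :
  connected_on e A -> connected_on e B -> B \subset A -> B != set0 ->
  #|B| <= m <= #|A| ->
  exists C, [/\ connected_on e C, B \subset C, C \subset A & #|C| = m].
Proof.
move=> cA + + + /andP[+ mA]; move def_d: (m - #|B|) => d.
elim: d B def_d => [|d IHd] B def_d cB sBA B0 Bm.
  by exists B; split=> //; lia.
have /set0Pn[a aB] := B0.
have /subsetPn[b bA bB] : ~~ (A \subset B).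
  by apply/negP => /subset_leq_card; lia.
have [x [y [xA xB yA yB xy]]] := connected_on_cut cA (subsetP sBA _ aB) aB bA bB.
have [|||||C [cC sC CA CE]] := IHd (y |: B).
- by rewrite cardsU1 yB; clear -def_d; lia.
- exact: connected_on_add cB xB xy.
- by rewrite subUset sub1set yA.
- by apply/set0Pn; exists y; rewrite setU11.
- by rewrite cardsU1 yB; clear -def_d; lia.
by exists C; split=> //; apply: subset_trans sC; apply: subsetUr.
Qed.

End Connectivity.

(** * From connected [k]-sets to all larger sets *)

Definition same_connected_large_sets (T : finType) (k : nat) (e e' : rel T) : Prop :=
  forall A : {set T}, k <= #|A| -> connected_on e A = connected_on e' A.

(* An edge inside a connected set [A] extends to a connected [k]-subset of [A]. *)
Lemma connected_ksets_large (T : finType) (k : nat) (e e' : rel T) (A : {set T}) :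
  symmetric e -> 1 < k -> connected_ksets k e' = connected_ksets k e ->
  k <= #|A| -> connected_on e A -> connected_on e' A.
Proof.
move=> esym k2 Ek kA cA; apply/connected_onP => x y xA yA.
apply: connect_sub ((connected_onP _ _ cA) x y xA yA) => a b /and3P[aA bA ab].
have cab : connected_on e (a |: [set b]).
  by apply: connected_on_star => // z /set1P->.
have [|||C [cC abC CA CE]] := connected_on_grow (m := k) esym cA cab.
- by rewrite subUset !sub1set aA.
- by apply/set0Pn; exists a; rewrite setU11.
- by rewrite cardsU1 cards1; case: (_ \notin _); lia.
have : C \in connected_ksets k e' by rewrite Ek inE CE eqxx.
rewrite inE => /andP[_ /connected_onP cC'].
by apply: connect_inducedS CA _; apply: cC'; apply: (subsetP abC); rewrite !inE eqxx ?orbT.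
Qed.

Lemma consistent_same_connected (T : finType) (k : nat) (e e' : rel T) :
  symmetric e -> symmetric e' -> 1 < k -> consistent k e e' ->
  same_connected_large_sets k e e'.
Proof.
move=> es es' k2 [Ek _] A kA; apply/idP/idP.
  exact: connected_ksets_large es k2 Ek kA.
exact: connected_ksets_large es' k2 (esym Ek) kA.
Qed.

(** * Bounds on the neighbourhood of a vertex where the two graphs differ *)

Section Neighbourhoods.
Variables (T : finType) (k : nat) (e e' : rel T).
Hypotheses (esym : symmetric e) (eirr : irreflexive e) (etf : triangle_free e).
Hypotheses (esym' : symmetric e') (eirr' : irreflexive e').
Hypotheses (k3 : 2 < k) (same : same_connected_large_sets k e e').
Implicit Types (A B : {set T}).

Definition nbhd (f : rel T) (u : T) : {set T} := [set w | f u w].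

Lemma not_connected_isolated (f : rel T) A x :
  x \in A -> 1 < #|A| -> {in A, forall y, ~~ f x y} ->
  ~~ connected_on f A.
Proof.
move=> xA A1 iso; apply/negP => cA.
by have [y /iso/negP] := connected_on_neighbour cA xA A1.
Qed.

(** With [k - 1] such vertices, [u] would be the centre of a star in [e'] on at least [k] vertices,
    yet isolated there in [e]. *)
Lemma card_nbhd_diff u : #|nbhd e' u :\: nbhd e u| <= k - 2.
Proof.
rewrite leqNgt; apply/negP => big.
set A := _ :\: _ in big; have uA : u \notin A by rewrite !inE eirr' andbF.
have cardA : #|u |: A| = #|A|.+1 by rewrite cardsU1 uA.
have : connected_on e' (u |: A).
  by apply: connected_on_star => // w; rewrite !inE => /andP[].
rewrite -same ?cardA; last by lia.
apply/negP; apply: (not_connected_isolated (x := u)); rewrite ?setU11 ?cardA //; first by lia.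
by move=> w /setU1P[->|]; rewrite ?eirr // !inE => /andP[].
Qed.

(** The common neighbours split by adjacency to [v] in [e']. At most [k - 3] are non-adjacent: with
    [u] and [v] they form a star at [u] in [e], where [v] is isolated in [e']. At most [k - 2] are
    adjacent: with [v] they form a star in [e'], where [v] is isolated in [e] by
    triangle-freeness. *)
Lemma card_nbhd_inter u v :
  e u v -> ~~ e' u v -> #|nbhd e u :&: nbhd e' u| <= 2 * k - 5.
Proof.
move=> uv uv'; rewrite leqNgt; apply/negP => big.
set I := _ :&: _ in big.
have vu : v != u by apply: contraTneq uv => ->; rewrite eirr.
have uI : u \notin I by rewrite !inE eirr.
have vI : v \notin I by rewrite !inE (negPf uv') andbF.
have cardM : #|I :\: nbhd e' v| <= k - 3.
  rewrite leqNgt; apply/negP => bigM; set M := _ :\: _ in bigM.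
  have uM : u \notin M by rewrite !inE eirr !andbF.
  have vM : v \notin M by rewrite in_setD (negPf vI) andbF.
  have cardA : #|u |: (v |: M)| = #|M|.+2.
    by rewrite !cardsU1 vM in_setU1 negb_or (eq_sym u) vu uM.
  have : connected_on e (u |: (v |: M)).
    by apply: connected_on_star => // w /setU1P[->//|]; rewrite !inE => /and3P[].
  rewrite same ?cardA; last by lia.
  apply/negP; apply: (not_connected_isolated (x := v)); rewrite ?cardA //.
    by rewrite !inE eqxx orbT.
  move=> w /setU1P[->|/setU1P[->|]]; rewrite ?eirr' 1?esym' //.
  by rewrite !inE 1?esym' => /andP[].
have cardJ : k - 1 <= #|I :&: nbhd e' v|.
  by have := cardsID (nbhd e' v) I; lia.
set J := I :&: _ in cardJ; have vJ : v \notin J by rewrite in_setI (negPf vI).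
have cardA : #|v |: J| = #|J|.+1 by rewrite cardsU1 vJ.
have : connected_on e' (v |: J).
  by apply: connected_on_star => // w; rewrite !inE => /andP[].
rewrite -same ?cardA; last by lia.
apply/negP; apply: (not_connected_isolated (x := v)); rewrite ?setU11 ?cardA //; first by lia.
move=> w /setU1P[->|]; rewrite ?eirr // !inE => /andP[/andP[uw _] _].
by apply/negP => vw; apply: (etf (x := u) (y := v) (z := w)).
Qed.

(** The bound is the sum of [k - 2] and [2 * k - 5]. *)
Lemma card_nbhd_differ u v : e u v -> ~~ e' u v -> #|nbhd e' u| <= 3 * k - 7.
Proof.
move=> uv uv'; have := card_nbhd_inter uv uv'; have := card_nbhd_diff u.
by have := cardsID (nbhd e u) (nbhd e' u); rewrite setIC; lia.
Qed.

(** * Components left after removing [u] and its [e']-neighbours *)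

Section Attachment.
Variables (u v : T).
Hypotheses (uv : e u v) (uv' : ~~ e' u v) (conn : connected_graph e).

Let N' := nbhd e' u.
Let D := ~: (u |: N').
Let DK := connect (induced e D).
(* [U] is the union of the components of [G - u - N'] that meet [N], [R] that
   of the others, and [attached x] that of the components in [R] adjacent to [x]. *)
Let U := [set w in D | [exists y in D, e u y && DK y w]].
Let R := D :\: U.
Let attached x := [set w in R | [exists y in D, e x y && DK y w]].

Lemma DKxx x : DK x x.
Proof. exact: connect0. Qed.

Lemma DK_sym x y : DK x y = DK y x.
Proof. exact: connect_induced_sym. Qed.

Lemma near_in_U y : y \in D -> e u y -> y \in U.
Proof.
by move=> yD uy; rewrite inE yD; apply/exists_inP; exists y; rewrite // uy DKxx.
Qed.

Lemma U_closed x y : x \in U -> DK x y -> y \in D -> y \in U.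
Proof.
rewrite !inE => /andP[_ /exists_inP[z zD /andP[uz zx]]] xy ->.
by apply/exists_inP; exists z; rewrite // uz; apply: connect_trans xy.
Qed.

Lemma R_closed x y : x \in R -> DK x y -> y \in D -> y \in R.
Proof.
case/setDP=> xD xU xy yD; apply/setDP; split=> //.
by apply: contra xU => yU; apply: U_closed yU _ xD; rewrite DK_sym.
Qed.

Lemma R_not_adjacent w : w \in R -> ~~ e u w.
Proof. by case/setDP=> wD; apply: contra; apply: near_in_U. Qed.

Lemma card_U : #|U| <= k - 2.
Proof.
rewrite leqNgt; apply/negP => big.
have uU : u \notin U by rewrite !inE eqxx.
have cardA : #|u |: U| = #|U|.+1 by rewrite cardsU1 uU.
have : connected_on e (u |: U).
  apply: (@connected_on_root _ _ _ _ u) => // w /setU1P[->|]; first exact: connect0.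
  rewrite inE => /andP[wD /exists_inP[y yD /andP[uy yw]]].
  have yU := near_in_U yD uy.
  have /andP[_ yw'] : (w \in U) && connect (induced e U) y w.
    apply: connect_induced_closed yU yw => a b aU Dab.
    by apply: U_closed aU (connect1 Dab) _; case/and3P: Dab.
  apply: connect_trans (connect_inducedS (subsetUr _ _) yw').
  by apply: connect1; rewrite /induced /= setU11 setU1r.
rewrite same ?cardA; last by lia.
apply/negP; apply: (not_connected_isolated (x := u)); rewrite ?setU11 ?cardA //; first by lia.
move=> w /setU1P[->|]; rewrite ?eirr' //.
by rewrite !inE => /andP[]; rewrite negb_or => /andP[].
Qed.

(** Since [e] is connected, some edge leaves the component [K] of [w] in [D]. Its outer end is
    outside [D], and it is not [u] because [R] contains no neighbour of [u]. *)
Lemma R_attached w : w \in R -> exists2 x, x \in N' & w \in attached x.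
Proof.
move=> wR; have [wD _] := setDP wR.
pose K := [set z | DK w z].
have KD z : z \in K -> z \in D.
  rewrite inE => wz.
  have /andP[//] : (z \in D) && connect (induced e D) w z.
    by apply: connect_induced_closed wD wz => a b _ /and3P[].
have uK : u \notin K by apply/negP => /KD; rewrite !inE eqxx.
have wK : w \in K by rewrite inE DKxx.
have [a [x [_ aK _ xK ax]]] := connected_on_cut conn (in_setT w) wK (in_setT u) uK.
have aD := KD a aK; have wa : DK w a by move: aK; rewrite inE.
have aw : DK a w by rewrite DK_sym.
have : x \notin D.
  apply: contra xK => xD; rewrite inE; apply: connect_trans wa _.
  by apply: connect1; rewrite /induced /= aD xD.
rewrite inE negbK => /setU1P[xu|xN].
  by have := R_not_adjacent (R_closed wR wa aD); rewrite esym -xu ax.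
exists x => //; rewrite inE wR; apply/exists_inP; exists a => //.
by rewrite esym ax.
Qed.

(** Otherwise the parts [u], [N'], [U] and [R] have together at most
    [1 + (3k - 7) + (k - 2) + (3k - 7)(k - 2)] vertices, one less than the assumed bound. *)
Lemma attached_large :
  k + (3 * k - 7) * (k - 1) <= #|T| -> exists2 x, x \in N' & k - 1 <= #|attached x|.
Proof.
move=> big; apply/exists_inP; apply: contraLR big => /exists_inPn small.
have cardR : #|R| <= #|N'| * (k - 2).
  apply: leq_trans (_ : \sum_(x in N') #|attached x| <= _).
    have sR : R \subset \bigcup_(x in N') attached x.
      by apply/subsetP => w /R_attached[x xN wx]; apply/bigcupP; exists x.
    apply: leq_trans (subset_leq_card sR) _.
    elim/big_rec2: _ => [|x n B _ IH]; first by rewrite cards0.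
    by rewrite (leq_trans (leq_card_setU _ _)) // leq_add2l.
  by rewrite -sum_nat_const; apply: leq_sum => x /small; lia.
have uN : u \notin N' by rewrite inE eirr'.
have UD : #|D :&: U| = #|U| by rewrite (setIidPr _) //; apply/subsetP => w; rewrite inE => /andP[].
have := cardsID U D; have := cardsC (u |: N'); rewrite cardsU1 uN UD -/D -/R.
by have := card_U; have := card_nbhd_differ uv uv'; rewrite -/N'; nia.
Qed.

Lemma attached_connected x : connected_on e (x |: attached x).
Proof.
apply: (@connected_on_root _ _ _ _ x) => // w /setU1P[->|]; first exact: connect0.
rewrite inE => /andP[wR /exists_inP[y yD /andP[xy yw]]].
have yA : y \in attached x.
  rewrite inE (R_closed wR _ yD) 1?DK_sym //=.
  by apply/exists_inP; exists y; rewrite // xy DKxx.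
have /andP[_ yw'] : (w \in attached x) && connect (induced e (attached x)) y w.
  apply: connect_induced_closed yA yw => a b + Dab.
  have bD : b \in D by case/and3P: Dab.
  rewrite inE => /andP[aR /exists_inP[z zD /andP[xz za]]].
  rewrite inE (R_closed aR (connect1 Dab) bD) /=.
  apply/exists_inP; exists z; rewrite // xz.
  exact: connect_trans za (connect1 Dab).
apply: connect_trans (connect_inducedS (subsetUr _ _) yw').
by apply: connect1; rewrite /induced /= setU11 setU1r.
Qed.

Lemma attached_contradiction x : x \in N' -> k - 1 <= #|attached x| -> False.
Proof.
move=> xN big; set B := x |: attached x.
have RD w : w \in R -> w \in D by case/setDP.
have aR w : w \in attached x -> w \in R by rewrite inE => /andP[].
have xA : x \notin attached x by apply/negP => /aR/RD; rewrite in_setC in_setU1 xN orbT.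
have cardB : k <= #|B| by rewrite cardsU1 xA; lia.
have B0 : 0 < #|B| by apply: leq_trans cardB; apply: ltnW (ltnW k3).
have cB := attached_connected x; rewrite -/B in cB.
have cB' : connected_on e' B by rewrite -same.
have xu : x != u by apply: contraTneq xN => ->; rewrite inE eirr'.
have uB : u \notin B.
  by rewrite in_setU1 eq_sym (negPf xu); apply/negP => /aR/RD; rewrite !inE eqxx.
(* The edge from [u] to [x] in [e'] gives connectedness there, which transfers to [e] by size. *)
have cuB : connected_on e (u |: B).
  rewrite same; last by rewrite cardsU1 uB leqW.
  by apply: connected_on_add cB' (setU11 _ _) _ => //; rewrite esym'; rewrite inE in xN.
(* Within [B] only [x] can be a neighbour of [u], as [R] contains none. *)
have ux : e u x.
  have [|y yuB uy] := connected_on_neighbour cuB (setU11 _ _).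
    by rewrite cardsU1 uB.
  case/setU1P: yuB uy => [->|/setU1P[->//|/aR/R_not_adjacent/negPf->//]].
  by rewrite eirr.
have vD : v \in D.
  by rewrite !inE negb_or uv' andbT; apply: contraTneq uv => ->; rewrite eirr.
have vU : v \in U by apply: near_in_U.
(* The vertex [x] is excluded by the triangle on [u], [v], [x]; a neighbour in [attached x] would
   share a component of [D] with [v] and so lie in [U], not in [R]. *)
have vB w : w \in B -> ~~ e v w.
  case/setU1P=> [->|wA]; apply/negP => vw; first exact: (etf (x := u) (y := v) (z := x)).
  have /setDP[wD /negP wU] := aR w wA; apply: wU.
  by apply: (U_closed vU _ wD); apply: connect1; rewrite /induced /= vD wD.
have vnB : v \notin B.
  apply/negP => /setU1P[vx|/aR/setDP[_ /negP//]].
  by move: xN; rewrite -vx inE (negPf uv').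
have cardA : #|v |: B| = #|B|.+1 by rewrite cardsU1 vnB.
have ncA : ~~ connected_on e' (v |: B).
  rewrite -same ?cardA ?leqW //.
  apply: (not_connected_isolated (x := v)); rewrite ?setU11 ?cardA //.
  by move=> w /setU1P[->|]; rewrite ?eirr //; apply: vB.
have uA : u \notin v |: B.
  by rewrite in_setU1 negb_or uB andbT; apply: contraTneq uv => <-; rewrite eirr.
have cA : connected_on e (v |: (u |: B)).
  by apply: connected_on_add cuB (setU11 _ _) _.
have cardA2 : #|v |: (u |: B)| = #|B|.+2 by rewrite setUCA cardsU1 uA cardA.
(* In [e'] the vertex [v] now needs a neighbour other than [u], hence one in [B], which would make
   [v |: B] connected. *)
move: cA; rewrite same ?cardA2; last by rewrite !leqW.
move=> /connected_on_neighbour/(_ (setU11 _ _))[]; first by rewrite cardA2.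
move=> y /setU1P[->|/setU1P[->|yB]]; rewrite ?eirr' 1?esym' ?(negPf uv') // => yv.
by move/negP: ncA; apply; apply: connected_on_add cB' yB yv.
Qed.

End Attachment.

(** * Transfer of edges and the reconstruction theorem *)

Lemma edge_transfer u v :
  connected_graph e -> k + (3 * k - 7) * (k - 1) <= #|T| -> e u v -> e' u v.
Proof.
move=> conn big uv; apply/negPn/negP => uv'.
have [x xN] := attached_large uv uv' conn big.
exact: (attached_contradiction uv uv' conn xN).
Qed.

End Neighbourhoods.

Theorem theorem6 (k : nat) (hk : 3 <= k) (T : finType) (e : rel T)
    (he : simple_graph e) (hconn : connected_graph e) (htf : triangle_free e)
    (hcard : (2 * k - 2) * (3 * k - 7) ^ 2 + 3 * k - 6 <= #|T|) :
  uniquely_reconstructible_in (@triangle_free T) k e.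
Proof.
split=> // e' [es' ei'] tf' cons; case: he => es ei.
have same := consistent_same_connected es es' (ltnW hk) cons.
(* The assumed bound is larger, since [3k - 7] is positive and [3k - 6] is at least [k] when [k] is
   at least 3. *)
have big : k + (3 * k - 7) * (k - 1) <= #|T|.
  have : (3 * k - 7) * (k - 1) <= (2 * k - 2) * (3 * k - 7) ^ 2.
    rewrite mulnC; apply: leq_mul; first by lia.
    by rewrite expnS expn1; apply: leq_pmulr; lia.
  by move: hcard; move: (_ ^ 2) => c; lia.
(* The whole vertex set has at least [k] elements, so [e'] is connected too and the two graphs can
   exchange roles. *)
have conn' : connected_graph e' by rewrite /connected_graph -same // cardsT; lia.
have same' : same_connected_large_sets k e' e by move=> A kA; rewrite same.
move=> u v; apply/idP/idP.
  exact: (edge_transfer es' ei' tf' es ei hk same').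
exact: (edge_transfer es ei htf es' ei' hk same).
Qed.
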